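(* Let $J\subseteq\{(i,j)\mid 1\le i<j\le n\}$ be closed. If the poset $\mathcal{P}_J$ determined by $J$ has no $4$-chains, then all superclasses of $U_J$ are conjugacy classes of $U_J$, and all supercharacters of $U_J$ are irreducible characters of $U_J$.
   Context: Let $\mathbb{F}_q$ be the finite field with $q$ elements. A set $J\subseteq\{(i,j)\mid 1\le i<j\le n\}$ is closed if $(i,j),(j,k)\in J$ implies $(i,k)\in J$. The associated poset $\mathcal{P}_J$ on $\{1,\dots,n\}$ has $i<j$ in $\mathcal{P}_J$ iff $(i,j)\in J$; a $4$-chain is a tuple $(i,j,k,l)$ with $(i,j),(j,k),(k,l)\in J$. Let $\mathfrak{n}_J$ be the algebra of $n\times n$ matrices over $\mathbb{F}_q$ whose $(i,j)$ entry is zero unless $(i,j)\in J$, and $U_J=1+\mathfrak{n}_J$ the pattern group. $U_J\times U_J$ acts on $\mathfrak{n}_J$ by left and right multiplication; a superclass of $U_J$ is a set $1+O$ with $O$ a two-sided orbit $\{uXv\mid u,v\in U_J\}$, $X\in\mathfrak{n}_J$. $U_J\times U_J$ acts on the dual space $\mathfrak{n}_J^*$ by $(u\lambda v)(X)=\lambda(u^{-1}Xv^{-1})$. Fix a nontrivial homomorphism $\theta:\mathbb{F}_q^+\to\mathbb{C}^\times$. The supercharacters of $U_J$ are the functions, for $\lambda\in\mathfrak{n}_J^*$, $$\chi^\lambda(1+X)=\frac{|\lambda U_J|}{|U_J\lambda U_J|}\sum_{\mu\in U_J\lambda U_J}\theta(\mu(X)),\qquad X\in\mathfrak{n}_J.$$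 *)

(* Defs.v *)
From HB Require Import structures.
From mathcomp Require Import all_boot all_order all_fingroup all_algebra.
From mathcomp Require Import all_solvable all_field all_character.

Set Implicit Arguments.
Unset Strict Implicit.
Unset Printing Implicit Defensive.

Import GRing.Theory.
Local Open Scope ring_scope.

(* Matrices have size n.+1, so that they are the elements of the ring
   underlying the finite group {'GL_n.+1[F]}; the indices 1, ..., n.+1 are the
   elements of 'I_n.+1. *)

Definition closed_set (n : nat) (J : {set 'I_n.+1 * 'I_n.+1}) : Prop :=
  (forall i j, (i, j) \in J -> (i < j)%N)
  /\ (forall i j k, (i, j) \in J -> (j, k) \in J -> (i, k) \in J).

Definition four_chain (n : nat) (J : {set 'I_n.+1 * 'I_n.+1})
    (i j k l : 'I_n.+1) : bool :=
  [&& (i, j) \in J, (j, k) \in J & (k, l) \in J].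

Section PatternGroup.

Variables (F : finFieldType) (n : nat) (J : {set 'I_n.+1 * 'I_n.+1}).

(* The entry of X at ij, with values in F seen as a vector space. *)
Definition mx_entry (ij : 'I_n.+1 * 'I_n.+1) (X : 'M[F]_n.+1) : F^o :=
  X ij.1 ij.2.

Lemma mx_entry_is_linear ij : linear (mx_entry ij).
Proof. by move=> a X Y; rewrite /mx_entry !mxE. Qed.

HB.instance Definition _ ij :=
  GRing.isLinear.Build F 'M[F]_n.+1 F^o *:%R (mx_entry ij)
    (mx_entry_is_linear ij).

Definition pattern_alg : {vspace 'M[F]_n.+1} :=
  (\bigcap_(ij | ij \notin J) lker (linfun (mx_entry ij)))%VS.

Lemma pattern_algP (X : 'M[F]_n.+1) :
  reflect (forall i j, (i, j) \notin J -> X i j = 0) (X \in pattern_alg).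
Proof.
rewrite /pattern_alg memvE; apply: (iffP subv_bigcapP) => H.
  by move=> i j /H; rewrite -memvE memv_ker lfunE => /eqP.
move=> [i j] /H Xij; rewrite -memvE memv_ker lfunE; exact/eqP.
Qed.

Definition pattern_set : {set {'GL_n.+1[F]}} :=
  [set g : {'GL_n.+1[F]} | GLval g - 1 \in pattern_alg].

Lemma pattern_group_set : closed_set J -> group_set pattern_set.
Proof.
case=> _ trJ; apply/group_setP; split; first by rewrite inE subrr mem0v.
move=> g h; rewrite !inE GL_ME => Xg Xh.
have -> : GLval g * GLval h - 1 =
    (GLval g - 1) * (GLval h - 1) + (GLval g - 1) + (GLval h - 1).
  by rewrite mulrBr mulr1 subrK mulrBl mul1r addrA subrK.
suff XY : (GLval g - 1) * (GLval h - 1) \in pattern_alg by do 2?[apply: memvD => //].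
move: Xg Xh.
move: (GLval g - 1) (GLval h - 1) => X Y /pattern_algP X0 /pattern_algP Y0.
apply/pattern_algP => i k ikJ; rewrite mxE big1 // => j _.
have [ijJ|/X0->] := boolP ((i, j) \in J); last by rewrite mul0r.
have [jkJ|/Y0->] := boolP ((j, k) \in J); last by rewrite mulr0.
by rewrite (trJ _ _ _ ijJ jkJ) in ikJ.
Qed.

Definition pattern_group (hJ : closed_set J) : {group {'GL_n.+1[F]}} :=
  Group (pattern_group_set hJ).

Definition two_sided_orbit (X : 'M[F]_n.+1) : {set 'M[F]_n.+1} :=
  [set GLval u *m X *m GLval v |
    u : {'GL_n.+1[F]} in pattern_set, v : {'GL_n.+1[F]} in pattern_set].

(* The set 1 + O, where O is the orbit of X: for J closed and X in
   pattern_alg, the elements of 1 + O are unitriangular, hence invertible. *)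
Definition superclass (X : 'M[F]_n.+1) : {set {'GL_n.+1[F]}} :=
  [set g : {'GL_n.+1[F]} | GLval g - 1 \in two_sided_orbit X].

(* finvect_type provides the finType structure. *)
Definition pattern_dual : predArgType :=
  finvect_type 'Hom(subvs_of pattern_alg, F^o).

HB.instance Definition _ := Finite.on pattern_dual.

Definition dual_eval (mu : pattern_dual) (X : subvs_of pattern_alg) : F :=
  (mu : 'Hom(subvs_of pattern_alg, F^o)) X.

(* (u lam v)(X) = lam (u^-1 X v^-1). The projection vsproj is the identity on
   pattern_alg, which contains u^-1 X v^-1 when J is closed. *)
Definition dual_act_fun (u : {'GL_n.+1[F]}) (lam : pattern_dual)
    (v : {'GL_n.+1[F]}) (X : subvs_of pattern_alg) : F^o :=
  dual_eval lam (vsproj pattern_alg (GLval u^-1 *m vsval X *m GLval v^-1)).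

Lemma dual_act_fun_is_linear u lam v : linear (dual_act_fun u lam v).
Proof.
move=> a X Y; rewrite /dual_act_fun /dual_eval.
rewrite [vsval _]linearP.
by rewrite mulmxDr mulmxDl -scalemxAr -scalemxAl !linearP.
Qed.

HB.instance Definition _ u lam v :=
  GRing.isLinear.Build F (subvs_of pattern_alg) F^o *:%R (dual_act_fun u lam v)
    (dual_act_fun_is_linear u lam v).

Definition dual_act (u : {'GL_n.+1[F]}) (lam : pattern_dual)
    (v : {'GL_n.+1[F]}) : pattern_dual :=
  linfun (dual_act_fun u lam v).

Lemma dual_actE u lam v X :
  dual_eval (dual_act u lam v) X = dual_act_fun u lam v X.
Proof. by rewrite /dual_eval /dual_act lfunE. Qed.

Definition dual_right_orbit (lam : pattern_dual) : {set pattern_dual} :=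
  [set dual_act 1%g lam v | v in pattern_set].

Definition dual_orbit (lam : pattern_dual) : {set pattern_dual} :=
  [set dual_act u lam v | u in pattern_set, v in pattern_set].

Definition supercharacter (theta : F -> algC) (lam : pattern_dual)
    (g : {'GL_n.+1[F]}) : algC :=
  #|dual_right_orbit lam|%:R / #|dual_orbit lam|%:R *
  \sum_(mu in dual_orbit lam)
     theta (dual_eval mu (vsproj pattern_alg (GLval g - 1))).

End PatternGroup.

(* A nontrivial homomorphism from the additive group of F to the multiplicative
   group of nonzero complex numbers. As F is finite, its values are roots of
   unity, so nothing is lost by taking them in algC. *)
Definition nontrivial_additive_character (F : finFieldType)
    (theta : F -> algC) : Prop :=
  [/\ forall x, theta x != 0,
      forall x y, theta (x + y) = theta x * theta y
    & exists x, theta x != 1].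

(* Main.v *)
(* Write n for the pattern algebra. Without 4-chains every X in n splits as
   X = A + B with A n = 0 and n B = 0. Hence n^3 = 0, and every uXv with u, v
   in U equals w^-1 X w for some w in U that does not depend on X.

   For the supercharacters put psi(g) = theta(lam(g - 1)) and
   B(g, h) = theta(lam((g - 1)(h - 1))). As n^3 = 0, B is bimultiplicative and
   psi(gh) = psi(g) psi(h) B(g, h); the splitting shows that U = L R, where L
   and R are the left and right radicals of B. Inducing the linear character
   psi of R to U gives |U : R| psi on the intersection of L and R and 0
   elsewhere. This has norm |U| |L :&: R| / |R|^2 = |L R| |L :&: R| / |R|^2 = 1,
   since |L| = |R|. The supercharacter of lam takes the same values, because
   averaging theta(lam(u(g - 1)v)) over u and v gives psi(g) times the averages
   of B(u, g) and B(g, v). *)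
Require Import Defs.
From mathcomp Require Import all_boot all_order all_fingroup all_algebra.
From mathcomp Require Import all_solvable all_field all_character.

Set Implicit Arguments.
Unset Strict Implicit.
Unset Printing Implicit Defensive.

Import GRing.Theory Num.Theory.
Local Open Scope ring_scope.

(** * Bicharacters of a finite group and their radicals *)

(** Translation by y multiplies the sum by [f y], so one value other than 1 forces it to vanish. *)
Lemma sum_multiplicative (gT : finGroupType) (G : {group gT}) (f : gT -> algC) :
    {in G &, {morph f : x y / (x * y)%g >-> x * y}} ->
  \sum_(x in G) f x = if [forall x in G, f x == 1] then #|G|%:R else 0.
Proof.
move=> fM; case: ifP => [/forall_inP f1 | /negbT].
  by rewrite (eq_bigr (fun=> 1)) ?sumr_const // => x /f1/eqP.
rewrite negb_forall_in => /exists_inP[y Gy fy1].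
have : (f y - 1) * \sum_(x in G) f x = 0.
  rewrite mulrBl mul1r mulr_sumr; apply/eqP; rewrite subr_eq0; apply/eqP.
  rewrite [RHS](reindex_inj (mulgI y)) /=.
  by apply: eq_big => x; rewrite ?groupMl // => Gx; rewrite fM.
by move/eqP; rewrite mulf_eq0 subr_eq0 (negPf fy1) => /eqP.
Qed.

Definition bicharacter (gT : finGroupType) (G : {set gT})
    (B : gT -> gT -> algC) : Prop :=
  [/\ {in G &, forall x y, B x y != 0},
      {in G & &, forall x y z, B (x * y)%g z = B x z * B y z}
    & {in G & &, forall x y z, B x (y * z)%g = B x y * B x z}].

Definition rradical (gT : finGroupType) (G : {set gT}) (B : gT -> gT -> algC) :=
  [set y in G | [forall x in G, B x y == 1]].

Definition lradical (gT : finGroupType) (G : {set gT}) (B : gT -> gT -> algC) :=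
  rradical G (fun x y => B y x).

Lemma bicharacter_flip (gT : finGroupType) (G : {set gT}) B :
  bicharacter G B -> bicharacter G (fun x y => B y x).
Proof.
case=> B0 Bl Br.
by split=> [x y Gx Gy | x y z Gx Gy Gz | x y z Gx Gy Gz]; 
  [exact: B0 | exact: Br | exact: Bl].
Qed.

Section Bicharacter.

Variables (gT : finGroupType) (G : {group gT}) (B : gT -> gT -> algC).
Hypothesis bB : bicharacter G B.

Lemma rradicalP y :
  reflect (y \in G /\ {in G, forall x, B x y = 1}) (y \in rradical G B).
Proof.
rewrite inE; apply: (iffP andP) => -[Gy By]; split=> //.
  by move=> x Gx; apply/eqP/(forall_inP By).
by apply/forall_inP => x /By->.
Qed.

Lemma bicharacter1r x : x \in G -> B x 1%g = 1.
Proof.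
case: bB => B0 _ Br Gx; apply: (mulfI (B0 x 1%g Gx (group1 G))).
by rewrite -Br ?group1 // mulr1 mulg1.
Qed.

Lemma group_set_rradical : group_set (rradical G B).
Proof.
case: bB => _ _ Br; apply/group_setP; split.
  by apply/rradicalP; split=> [|x Gx]; rewrite ?group1 ?bicharacter1r.
move=> y z /rradicalP[Gy By] /rradicalP[Gz Bz].
by apply/rradicalP; split=> [|x Gx]; rewrite ?groupM // Br // By // Bz // mulr1.
Qed.

(** The values of [B x] commute, so [B x] is constant on conjugacy classes; this makes the radicals
    normal. *)
Lemma bicharacterJr x y z :
  x \in G -> y \in G -> z \in G -> B x (y ^ z)%g = B x y.
Proof.
case: bB => B0 _ Br Gx Gy Gz; apply: (mulfI (B0 x z Gx Gz)).
by rewrite -Br ?groupJ // -conjgC Br // mulrC.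
Qed.

Lemma sum_bicharacter :
  \sum_(x in G) \sum_(y in G) B y x = #|G|%:R * #|rradical G B|%:R.
Proof.
case: bB => _ Bl _.
under eq_bigr => x Gx.
  rewrite (sum_multiplicative (f := B^~ x)); last first.
    by move=> y z Gy Gz; apply: Bl.
over.
rewrite -big_mkcondr /= sumr_const -[LHS]mulr_natr; congr (_ * _%:R).
by apply: eq_card => x; rewrite !inE.
Qed.

End Bicharacter.

(** Summing [B] over pairs in the two orders gives [#|G|] times either radical's order. *)
Lemma card_lradical (gT : finGroupType) (G : {group gT}) B :
  bicharacter G B -> #|lradical G B| = #|rradical G B|.
Proof.
move=> bB; have := sum_bicharacter (bicharacter_flip bB).
rewrite exchange_big /= sum_bicharacter // => /mulfI E.
by apply/eqP; rewrite -(eqr_nat algC) E ?neq0CG.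
Qed.

(* psi is a quadratic refinement of B. It is multiplicative on the right
   radical R, and the irreducible character is induced from psi on R. *)
Lemma irr_quadratic (gT : finGroupType) (G : {group gT}) B (psi : gT -> algC) :
    bicharacter G B -> G \subset (lradical G B * rradical G B)%g ->
    {in G, forall x, psi x != 0} ->
    {in G &, forall x y, psi (x * y)%g = psi x * psi y * B x y} ->
  exists2 chi : 'CF(G), chi \in irr G &
    {in G, forall x, chi x = #|G|%:R / #|rradical G B|%:R *
      (psi x *+ (x \in lradical G B :&: rradical G B))}.
Proof.
move=> bB GLR psi0 psiM; have [B0 Bl Br] := bB.
pose R := Group (group_set_rradical bB).
pose L := Group (group_set_rradical (bicharacter_flip bB)).
have RP y : reflect (y \in G /\ {in G, forall x, B x y = 1}) (y \in R).
  exact: rradicalP.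
have LP x : reflect (x \in G /\ {in G, forall y, B x y = 1}) (x \in L).
  exact: rradicalP.
have sRG : R \subset G by apply/subsetP => x /RP[].
have sLG : L \subset G by apply/subsetP => x /LP[].
have psi1 : psi 1%g = 1.
  apply: (mulfI (psi0 1%g (group1 G))); rewrite mulr1 -{3}(mulg1 1%g) psiM //.
  by rewrite (bicharacter1r bB) // mulr1.
have rho_repr : mx_repr R (fun x => (psi x)%:M : 'M[algC]_1).
  split=> [|x y /RP[Gx _] /RP[Gy By]]; first by rewrite psi1.
  by rewrite psiM // By // mulr1 scalar_mxM.
pose rho := cfRepr (MxRepresentation rho_repr).
have rhoE x : rho x = psi x *+ (x \in R) by rewrite cfunE /= mxtrace_scalar.
have rho_lin : rho \is a linear_char.
  by apply/andP; split; [exact: cfRepr_char | rewrite cfRepr1].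
have RJ x y : x \in G -> y \in G -> (x ^ y \in R)%g = (x \in R).
  move=> Gx Gy; apply/RP/RP => -[_ Bx]; split=> [|z Gz]; rewrite ?groupJ //.
    by rewrite -(Bx z Gz) (bicharacterJr bB).
  by rewrite (bicharacterJr bB) // Bx.
(* Expand [psi] at [x * y = y * x ^ y] in both ways; [B y (x ^ y) = B y x = 1] since x is in R. *)
have psiJ x y : x \in R -> y \in G -> psi (x ^ y)%g = psi x * B x y.
  case/RP=> Gx Bx Gy; apply: (mulfI (psi0 y Gy)).
  have := psiM y (x ^ y)%g Gy (groupJ Gx Gy).
  rewrite -conjgC psiM // (bicharacterJr bB) // Bx // mulr1 => <-.
  by rewrite mulrAC mulrC mulrA.
(* For x in R the induction sum is [psi x] times the sum of [B x] over G, which is 0 unless x lies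
   in L. *)
have chiE : {in G, forall x, 'Ind[G] rho x =
    #|G|%:R / #|R|%:R * (psi x *+ (x \in L :&: R))}.
  move=> x Gx; rewrite cfIndE // inE.
  under eq_bigr => y Gy do rewrite rhoE RJ //.
  have [Rx|_] := boolP (x \in R); last first.
    by rewrite andbF big1 ?mulr0.
  under eq_bigr => y Gy do rewrite psiJ //.
  rewrite andbT -mulr_sumr (sum_multiplicative (f := B x)); last first.
    by move=> y z Gy Gz; apply: Br.
  have ->: [forall y in G, B x y == 1] = (x \in L) by rewrite [RHS]inE Gx.
  case: (x \in L); rewrite ?mulr0 // mulr1n [psi x * _]mulrC.
  by rewrite mulrCA mulrA.
exists ('Ind[G] rho) => //.
rewrite irrEchar cfInd_char ?lin_charW //=.
have supp : 'Ind[G] rho \in 'CF(G, L :&: R).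
  apply/cfun_onP => x LRx; have [Gx|nGx] := boolP (x \in G).
    by rewrite chiE // (negPf LRx) mulr0.
  by rewrite cfun0.
(* On R, [psi] is a linear character and has modulus 1, so the inner product of the induced
   character with itself is |G| |L :&: R| / |R|^2. *)
rewrite (cfnormE supp).
rewrite (eq_bigr (fun=> (#|G|%:R / #|R|%:R) ^+ 2)); last first.
  move=> x LRx; have [Lx Rx] := setIP LRx.
  rewrite chiE ?(subsetP sRG) // LRx normrM normf_div !normr_nat.
  by have := normC_lin_char rho_lin Rx; rewrite rhoE Rx => ->; rewrite mulr1.
have cardE : (#|R| * #|R| = #|G| * #|L :&: R|)%N.
  rewrite -{1}(card_lradical bB) (mul_cardG L R); congr (_ * _)%N.
  apply: eq_card => x; apply/idP/idP => [|/(subsetP GLR)//].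
  by move=> /mulsgP[l r /LP[Gl _] /RP[Gr _] ->]; rewrite groupM.
have cG : #|G|%:R != 0 :> algC by exact: neq0CG.
have cLR : #|L :&: R|%:R != 0 :> algC by exact: neq0CG.
have cardC : #|R|%:R * #|R|%:R = #|G|%:R * #|L :&: R|%:R :> algC.
  by rewrite -!natrM cardE.
rewrite sumr_const -[X in _ * X]mulr_natr expr2 mulf_div cardC -mulf_div.
by rewrite divff // mul1r divfK // mulVf.
Qed.

(** * Averages over orbits *)

(** Like an orbit map, [f] has as fibres the left translates of the fibre over [f 1%g], all of equal
    size. *)
Lemma sum_equivariant (gT : finGroupType) (G : {group gT}) (T : finType)
    (f : gT -> T) (phi : T -> algC) :
    {in G & &, forall x y z, f y = f z -> f (x * y)%g = f (x * z)%g} ->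
  \sum_(x in G) phi (f x) =
    #|[set x in G | f x == f 1%g]|%:R * \sum_(t in f @: G) phi t.
Proof.
move=> fM; rewrite (partition_big_imset f) /= mulr_sumr.
apply: eq_bigr => _ /imsetP[y Gy ->].
rewrite (eq_bigr (fun=> phi (f y))) => [|x /andP[_ /eqP->]] //.
rewrite sumr_const -[LHS]mulr_natl; congr (_%:R * _).
rewrite -[RHS](card_imset _ (mulgI y)); apply: eq_card => x.
apply/idP/imsetP => [/andP[Gx /eqP fxy] | [z + ->]].
  exists (y^-1 * x)%g; last by rewrite mulKVg.
  rewrite inE groupM ?groupV //=; apply/eqP.
  by rewrite -(mulVg y); apply: fM; rewrite ?groupV.
rewrite inE => /andP[Gz /eqP fz]; apply/andP; split; first by rewrite groupM.
by rewrite -{2}(mulg1 y); apply/eqP/fM; rewrite ?group1.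
Qed.

Lemma card_equivariant (gT : finGroupType) (G : {group gT}) (T : finType)
    (f : gT -> T) :
    {in G & &, forall x y z, f y = f z -> f (x * y)%g = f (x * z)%g} ->
  #|G|%:R = #|[set x in G | f x == f 1%g]|%:R * #|f @: G|%:R :> algC.
Proof. by move/(sum_equivariant (fun=> 1)); rewrite !sumr_const. Qed.

Lemma mean_equivariant (gT : finGroupType) (G : {group gT}) (T : finType)
    (f : gT -> T) (phi : T -> algC) :
    {in G & &, forall x y z, f y = f z -> f (x * y)%g = f (x * z)%g} ->
  (\sum_(t in f @: G) phi t) / #|f @: G|%:R =
    (\sum_(x in G) phi (f x)) / #|G|%:R.
Proof.
move=> fM; rewrite (sum_equivariant phi fM) (card_equivariant fM).
rewrite -mulf_div divff ?mul1r //.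
have := neq0CG G; rewrite (card_equivariant fM) mulf_eq0 negb_or.
by case/andP.
Qed.

(** * Group elements as matrices *)

(* GLval has codomain 'M_n.+1.-1.+1, which rewriting does not identify with
   'M_n.+1. The lock keeps unification from unfolding products in the group
   to products of matrices. *)
Fact gl_mx_key : unit. Proof. by []. Qed.
Definition gl_mx (F : finFieldType) (n : nat) (g : {'GL_n.+1[F]}) : 'M[F]_n.+1 :=
  locked_with gl_mx_key (GLval g).

Lemma gl_mxE (F : finFieldType) (n : nat) (g : {'GL_n.+1[F]}) :
  gl_mx g = GLval g.
Proof. exact: locked_withE. Qed.

Lemma gl_mx_inj (F : finFieldType) (n : nat) : injective (@gl_mx F n).
Proof. by move=> g h; rewrite !gl_mxE => E; apply/val_inj/E. Qed.

Lemma gl_mxM (F : finFieldType) (n : nat) (g h : {'GL_n.+1[F]}) :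
  gl_mx (g * h)%g = gl_mx g * gl_mx h.
Proof. by rewrite !gl_mxE. Qed.

Lemma gl_mx1 (F : finFieldType) (n : nat) :
  gl_mx (1%g : {'GL_n.+1[F]}) = 1.
Proof. by rewrite gl_mxE. Qed.

Lemma gl_mxM_sub1 (F : finFieldType) (n : nat) (g h : {'GL_n.+1[F]}) :
  gl_mx (g * h)%g - 1 =
    gl_mx g - 1 + (gl_mx h - 1) + (gl_mx g - 1) * (gl_mx h - 1).
Proof.
rewrite gl_mxM [(_ - 1) * _]mulrBr mulr1 mulrBl mul1r [RHS]addrC.
by rewrite addrA subrK addrA subrK.
Qed.


(** * Pattern algebras and groups without 4-chains *)

Section PatternGroup.

Variables (F : finFieldType) (n : nat) (J : {set 'I_n.+1 * 'I_n.+1}).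
Hypothesis hJ : closed_set J.
Hypothesis no4 : ~ exists i j k l : 'I_n.+1, four_chain J i j k l.

Notation nJ := (pattern_alg F J).
Notation U := (pattern_group F hJ).

Lemma pattern_alg_mul (X Y : 'M[F]_n.+1) : X \in nJ -> Y \in nJ -> X * Y \in nJ.
Proof.
case: hJ => _ trJ /pattern_algP X0 /pattern_algP Y0.
apply/pattern_algP => i k ikJ; rewrite mxE big1 // => j _.
have [ijJ|/X0->] := boolP ((i, j) \in J); last by rewrite mul0r.
have [jkJ|/Y0->] := boolP ((j, k) \in J); last by rewrite mulr0.
by rewrite (trJ _ _ _ ijJ jkJ) in ikJ.
Qed.

(* The entries of X in the columns of maximal elements of the poset form A.
   Any other (i, j) in J has i minimal, since there are no 4-chains. *)
Lemma pattern_alg_split (X : 'M[F]_n.+1) : X \in nJ ->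
  exists2 A, [/\ A \in nJ, X - A \in nJ & {in nJ, forall Y, A * Y = 0}]
    & {in nJ, forall Y, Y * (X - A) = 0}.
Proof.
move=> nX; have /pattern_algP X0 := nX; pose m (j : 'I_n.+1) := [forall k, (j, k) \notin J].
pose A : 'M[F]_n.+1 := \matrix_(i, j) (X i j *+ m j).
have nA : A \in nJ.
  apply/pattern_algP => i j ijJ.
  by rewrite mxE X0 // mul0rn.
exists A; first split=> //; first exact: memvB.
  move=> Y /pattern_algP Y0; apply/matrixP => i k; rewrite !mxE big1 // => j _.
  rewrite mxE; have [/forallP/(_ k)/Y0->|_] := boolP (m j); first by rewrite mulr0.
  by rewrite mul0r.
move=> Y /pattern_algP Y0; apply/matrixP => i k; rewrite !mxE big1 // => j _.
rewrite !mxE; have [_|] := boolP (m k); first by rewrite subrr mulr0.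
rewrite subr0 negb_forall => /existsP[l /negPn klJ].
have [ijJ|/Y0->] := boolP ((i, j) \in J); last by rewrite mul0r.
have [jkJ|njk] := boolP ((j, k) \in J).
  by case: no4; exists i, j, k, l; rewrite /four_chain ijJ jkJ.
by rewrite X0 // mulr0.
Qed.

(** One part of [Y] is killed by [Z] on the right, the other by [X] on the left. *)
Lemma pattern_alg_mul3 (X Y Z : 'M[F]_n.+1) :
  X \in nJ -> Y \in nJ -> Z \in nJ -> X * Y * Z = 0.
Proof.
move=> nX /pattern_alg_split[A [_ _ A0] B0] nZ.
have XY : X * Y = X * A by apply/eqP; rewrite -subr_eq0 -mulrBr B0.
by rewrite XY -mulrA A0 // mulr0.
Qed.

Lemma pattern_groupP (g : {'GL_n.+1[F]}) : reflect (gl_mx g - 1 \in nJ) (g \in U).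
Proof. by rewrite inE gl_mxE; apply: idP. Qed.

Lemma pattern_group_exists (X : 'M[F]_n.+1) :
  X \in nJ -> exists2 g, g \in U & gl_mx g - 1 = X.
Proof.
move=> nX.
have X3 : X * X * X = 0 by exact: pattern_alg_mul3.
have unitX : (1 + X) \is a GRing.unit.
  apply/unitrP; exists (1 - X + X * X).
  split; [rewrite mulrDr mulr1 mulrDl mulrBl mul1r |
          rewrite mulrDl mul1r mulrDr mulrBr mulr1 mulrA];
    by rewrite X3 addr0 addrACA subrr addr0 subrK.
pose g : {'GL_n.+1[F]} := FinRing.unit _ unitX.
have gE : gl_mx g - 1 = X by rewrite gl_mxE addrC addKr.
by exists g => //; apply/pattern_groupP; rewrite gE.
Qed.

(** If A + B is the splitting of g - 1, then AB = 0 gives g = (1 + A)(1 + B). *)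
Lemma pattern_group_split g : g \in U ->
  exists l r, [/\ l \in U, r \in U & g = (l * r)%g] /\
    {in nJ, forall X, (gl_mx l - 1) * X = 0 /\ X * (gl_mx r - 1) = 0}.
Proof.
move=> /pattern_groupP nX; have [A [nA nB A0] B0] := pattern_alg_split nX.
have [l Ul lE] := pattern_group_exists nA.
have [r Ur rE] := pattern_group_exists nB.
exists l, r; split; last by move=> X nX'; rewrite lE rE A0 ?B0.
split=> //; apply: gl_mx_inj; rewrite gl_mxM.
have -> : gl_mx l = 1 + A by rewrite -lE addrC subrK.
have -> : gl_mx r = 1 + (gl_mx g - 1 - A) by rewrite -rE addrC subrK.
rewrite mulrDl mul1r [A * _]mulrDr mulr1 A0 // addr0.
by rewrite -addrA subrK addrC subrK.
Qed.

Lemma pattern_group_mull g X : g \in U -> X \in nJ -> gl_mx g * X \in nJ.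
Proof.
move=> /pattern_groupP ng nX.
by rewrite -[gl_mx g](subrK 1) mulrDl mul1r memvD ?pattern_alg_mul.
Qed.

Lemma pattern_group_mulr g X : g \in U -> X \in nJ -> X * gl_mx g \in nJ.
Proof.
move=> /pattern_groupP ng nX.
by rewrite -[gl_mx g](subrK 1) mulrDr mulr1 memvD ?pattern_alg_mul.
Qed.

(* Split uv = lr, where l acts trivially on nJ from the left and r from the
   right. Then w = u^-1 l = v r^-1. *)
Lemma two_sided_conj u v : u \in U -> v \in U ->
  exists2 w, w \in U &
    {in nJ, forall X, gl_mx u * X * gl_mx v = gl_mx w^-1 * X * gl_mx w}.
Proof.
move=> Uu Uv; have [l [r [[Ul Ur uvE] lr1]]] := pattern_group_split (groupM Uu Uv).
exists (u^-1 * l)%g => [|X nX]; first by rewrite groupM ?groupV.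
have wE : (u^-1 * l = v * r^-1)%g by rewrite -(mulKg u v) uvE !mulgA mulgK.
have Yl Y : Y \in nJ -> gl_mx l * Y = Y.
  by case/lr1=> + _; rewrite mulrBl mul1r => /eqP; rewrite subr_eq0 => /eqP.
have Yr Y : Y \in nJ -> Y * gl_mx r = Y.
  by case/lr1=> _; rewrite mulrBr mulr1 => /eqP; rewrite subr_eq0 => /eqP.
have nuXv : gl_mx u * X * gl_mx v \in nJ.
  by rewrite pattern_group_mulr ?pattern_group_mull.
have lw : gl_mx l * gl_mx (u^-1 * l)^-1 = gl_mx u.
  by rewrite -gl_mxM invMg invgK mulKVg.
have wr : gl_mx (u^-1 * l) * gl_mx r = gl_mx v by rewrite -gl_mxM wE mulgKV.
(* Here l w^-1 = u and w r = v; as w^-1 X w lies in [nJ], the outer factors l and r can then be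
   dropped. *)
have : gl_mx l * (gl_mx (u^-1 * l)^-1 * X * gl_mx (u^-1 * l)) * gl_mx r =
   gl_mx u * X * gl_mx v.
  by rewrite !mulrA lw -!mulrA wr.
rewrite Yl ?Yr //; rewrite pattern_group_mulr ?pattern_group_mull ?groupV //;
  by rewrite groupM ?groupV.
Qed.

(** * Superclasses *)

(** By [two_sided_conj] the orbit of g - 1 is its orbit under conjugation, and w^-1 (g - 1) w = g^w
    - 1. *)
Lemma superclass_class X : X \in nJ -> superclass J X \in classes U.
Proof.
move=> /pattern_group_exists[g Ug <-]; apply/imsetP; exists g => //.
have gJ (w : {'GL_n.+1[F]}) :
    gl_mx w^-1 * (gl_mx g - 1) * gl_mx w = gl_mx (g ^ w)%g - 1.
  rewrite conjgE !gl_mxM mulrBr mulrBl mulr1 mulrA; congr (_ - _).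
  by rewrite -gl_mxM mulVg gl_mx1.
apply/setP => h.
rewrite (_ : (h \in _) = (gl_mx h - 1 \in two_sided_orbit J (gl_mx g - 1))); last first.
  by rewrite !gl_mxE inE.
apply/imset2P/imsetP => [[u v Uu Uv] | [w Uw ->]].
  rewrite -[GLval u]gl_mxE -[GLval v]gl_mxE => hE.
  have [w Uw wE] := two_sided_conj Uu Uv; exists w => //.
  apply: gl_mx_inj; apply: (addIr (-1)); rewrite -gJ [LHS]hE.
  by apply/wE/pattern_groupP.
have UwV : w^-1%g \in U by rewrite groupV.
exists w^-1%g w; [exact: UwV | exact: Uw |].
by rewrite -[GLval w]gl_mxE -[GLval w^-1]gl_mxE -gJ.
Qed.

(** * The action on the dual space *)

(** Composition with the projection onto [nJ] makes functionals linear on plain matrices. *)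
Definition dual_ev (lam : pattern_dual F J) (X : 'M[F]_n.+1) : F :=
  dual_eval lam (vsproj nJ X).

Lemma dual_evD lam X Y : dual_ev lam (X + Y) = dual_ev lam X + dual_ev lam Y.
Proof. by rewrite /dual_ev /dual_eval !linearD. Qed.

Lemma dual_evZ lam a X : dual_ev lam (a *: X) = a * dual_ev lam X.
Proof. by rewrite /dual_ev /dual_eval !linearZ. Qed.

Lemma dual_ev_inj lam mu : {in nJ, dual_ev lam =1 dual_ev mu} -> lam = mu.
Proof.
move=> E; apply/lfunP => X; have := E (vsval X) (subvsP X).
by rewrite /dual_ev !vsvalK.
Qed.

Lemma dual_ev_act u (lam : pattern_dual F J) v : {in nJ, forall X,
  dual_ev (dual_act u lam v) X = dual_ev lam (gl_mx u^-1 * X * gl_mx v^-1)}.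
Proof.
move=> X nX; rewrite {1}/dual_ev dual_actE /dual_act_fun vsprojK //.
by rewrite !gl_mxE.
Qed.

Lemma dual_actM u1 u2 (lam : pattern_dual F J) v1 v2 : u1 \in U -> v2 \in U ->
  dual_act (u1 * u2)%g lam (v1 * v2)%g = dual_act u1 (dual_act u2 lam v1) v2.
Proof.
move=> Uu Uv; apply: dual_ev_inj => X nX; rewrite !dual_ev_act //.
  by rewrite !invMg !gl_mxM !mulrA.
by rewrite pattern_group_mulr ?pattern_group_mull ?groupV.
Qed.

(** Inverting the second factor turns the right action into a left one, as [mean_equivariant]
    requires. *)
Lemma dual_orbitE (lam : pattern_dual F J) :
  dual_orbit lam =
    [set dual_act p.1 lam p.2^-1 | p in setX U U].
Proof.
apply/setP => mu; apply/imset2P/imsetP => [[u v Uu Uv ->] | [[u v] /setXP[Uu Uv] ->]].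
  exists (u, v^-1)%g; last by rewrite invgK.
  by apply/setXP; split; [exact: Uu | rewrite groupV; exact: Uv].
by exists u v^-1%g; [exact: Uu | rewrite -[_ \in _]/(v^-1%g \in U) groupV |].
Qed.

Lemma dual_right_orbitE (lam : pattern_dual F J) :
  dual_right_orbit lam = [set dual_act 1%g lam v^-1 | v in U].
Proof.
apply/setP => mu; apply/imsetP/imsetP => -[v Uv ->]; exists v^-1%g;
  by rewrite ?invgK // -[_ \in _]/(v^-1%g \in U) groupV.
Qed.

(** * The values of supercharacters *)

Section Supercharacter.

Variables (theta : F -> algC) (lam : pattern_dual F J).
Hypothesis htheta : nontrivial_additive_character theta.

Definition pattern_psi (g : {'GL_n.+1[F]}) : algC :=
  theta (dual_ev lam (gl_mx g - 1)).

Definition pattern_bichar (g h : {'GL_n.+1[F]}) : algC :=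
  theta (dual_ev lam ((gl_mx g - 1) * (gl_mx h - 1))).

Notation psi := pattern_psi.
Notation B := pattern_bichar.

Lemma theta_dual_evD X Y :
  theta (dual_ev lam (X + Y)) = theta (dual_ev lam X) * theta (dual_ev lam Y).
Proof. by case: htheta => _ thetaD _; rewrite dual_evD thetaD. Qed.

Lemma additive_char0 : theta 0 = 1.
Proof.
case: htheta => theta_neq0 thetaD _; apply: (mulfI (theta_neq0 0)).
by rewrite -thetaD addr0 mulr1.
Qed.

Lemma theta_dual_ev0 : theta (dual_ev lam 0) = 1.
Proof. by rewrite -(scale0r 0) dual_evZ mul0r additive_char0. Qed.

(** As gh - 1 = (g - 1) + (h - 1) + (g - 1)(h - 1), the defect from multiplicativity is a product of
    three elements of [nJ], hence 0. *)
Lemma pattern_bicharP : bicharacter U B.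
Proof.
case: htheta => theta_neq0 _ _.
split=> [g h _ _ | x y z Ux Uy Uz | x y z Ux Uy Uz]; first exact: theta_neq0.
- move/pattern_groupP: Ux Uy Uz => nx /pattern_groupP ny /pattern_groupP nz.
  by rewrite /B gl_mxM_sub1 mulrDl pattern_alg_mul3 // addr0 mulrDl theta_dual_evD.
move/pattern_groupP: Ux Uy Uz => nx /pattern_groupP ny /pattern_groupP nz.
by rewrite /B gl_mxM_sub1 mulrDr mulrA pattern_alg_mul3 // addr0 mulrDr theta_dual_evD.
Qed.

Lemma pattern_psiM g h : psi (g * h)%g = psi g * psi h * B g h.
Proof. by rewrite /psi gl_mxM_sub1 2!theta_dual_evD. Qed.

Lemma pattern_group_radicals : U \subset (lradical U B * rradical U B)%g.
Proof.
apply/subsetP => g /pattern_group_split[l [r [[Ul Ur ->] lr1]]].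
apply: mem_mulg; rewrite inE.
  rewrite Ul; apply/forall_inP => x /pattern_groupP/lr1[E _].
  by rewrite /B E theta_dual_ev0.
rewrite Ur; apply/forall_inP => x /pattern_groupP/lr1[_ E].
by rewrite /B E theta_dual_ev0.
Qed.

(** Both sides say that lam(X(v - 1)) = 0 for all X in [nJ]. [B] sees this value only through
    [theta], which may have a kernel; scaling X gets around it. *)
Lemma dual_act_fixed v : v \in U ->
  (dual_act 1%g lam v^-1 == dual_act 1%g lam 1^-1) =
    [forall g in U, B g v == 1].
Proof.
move=> Uv; case: htheta => _ _ [y thetay].
have evv X : dual_ev lam (X * gl_mx v) =
    dual_ev lam X + dual_ev lam (X * (gl_mx v - 1)).
  by rewrite -dual_evD mulrBr mulr1 addrC subrK.
apply/eqP/forall_inP => [E g /pattern_groupP ng | B1].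
  have := congr1 (dual_ev^~ (gl_mx g - 1)) E.
  rewrite /= !dual_ev_act // !invg1 invgK gl_mx1 mul1r mulr1 evv => /eqP.
  by rewrite -subr_eq0 addrC addKr => /eqP t0; rewrite /B t0 additive_char0.
apply: dual_ev_inj => X nX.
rewrite !dual_ev_act // !invg1 invgK gl_mx1 mul1r mulr1 evv.
have [->|t0] := eqVneq (dual_ev lam (X * (gl_mx v - 1))) 0; first by rewrite addr0.
(* This multiple of X moves the nonzero value to [y], where [theta] is not 1. *)
have [g /B1 + gE] := pattern_group_exists (memvZ (y / dual_ev lam (X * (gl_mx v - 1))) nX).
by rewrite /B gE -scalerAl dual_evZ divfK // (negPf thetay).
Qed.

(** Orbit-stabilizer: by [dual_act_fixed] the stabilizer of [lam] is the right radical. *)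
Lemma card_dual_right_orbit :
  #|dual_right_orbit lam|%:R = #|U|%:R / #|rradical U B|%:R :> algC.
Proof.
rewrite dual_right_orbitE (card_equivariant (f := fun v => dual_act 1%g lam v^-1)).
  set S := [set x in _ | _]; have -> : S = rradical U B.
    apply/setP => v; rewrite [LHS]inE [RHS]inE; apply: andb_id2l => Uv.
    exact: dual_act_fixed.
  by rewrite mulrC mulKf // (neq0CG (Group (group_set_rradical pattern_bicharP))).
move=> x y z Ux Uy Uz E; rewrite !invMg -[1%g]mulg1.
by rewrite !dual_actM ?groupV // E.
Qed.

Lemma supercharacterE : {in U, forall g, supercharacter theta lam g =
  #|U|%:R / #|rradical U B|%:R * (psi g *+ (g \in lradical U B :&: rradical U B))}.
Proof.
move=> g Ug; have [_ Bl Br] := pattern_bicharP.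
have /pattern_groupP ng := Ug.
pose phi mu := theta (dual_ev mu (gl_mx g - 1)).
pose f p := dual_act p.1 lam p.2^-1.
rewrite /supercharacter -mulrA [_^-1 * _]mulrC card_dual_right_orbit.
congr (_ * _).
rewrite (eq_bigr phi); last by move=> mu _; rewrite /phi gl_mxE.
(* The mean over the two-sided orbit becomes a mean over U x U. *)
rewrite dual_orbitE (mean_equivariant (f := f) phi) /=; last first.
  move=> [x x'] [y y'] [z z'] /setXP[/= Ux Ux'] _ _ E; rewrite /f /= !invMg.
  by rewrite !dual_actM ?groupV //; congr dual_act.
have -> : \sum_(p in setX U U) phi (f p) =
    psi g * (\sum_(u in U) B u^-1 g) * (\sum_(v in U) B g v).
  rewrite -mulrA mulr_suml mulr_sumr.
  under [RHS]eq_bigr do rewrite mulr_sumr mulr_sumr.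
  rewrite pair_big /=; apply: eq_big => [[u v]|[u v] /setXP[/= Uu Uv]].
    by rewrite !inE.
  rewrite /phi dual_ev_act //= invgK.
  (* Expand (u^-1 - 1 + 1)(g - 1)(v - 1 + 1): the triple product vanishes, and the other terms give
     [psi g], [B u^-1 g] and [B g v]. *)
  rewrite -[gl_mx u^-1](subrK 1) -[gl_mx v](subrK 1).
  have /pattern_groupP nu : (u^-1)%g \in U by rewrite groupV.
  have /pattern_groupP nv := Uv.
  rewrite mulrDr mulr1 mulrDl mul1r mulrDl pattern_alg_mul3 // add0r.
  rewrite 2!theta_dual_evD.
  by rewrite mulrC [X in X * _]mulrC -mulrA.
(* Each sum is [#|U|] or 0, so together they cut out the intersection of the radicals. *)
have -> : \sum_(u in U) B u^-1 g = if g \in rradical U B then #|U|%:R else 0.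
  rewrite (reindex_inj invg_inj) (eq_bigl (mem U)) => [|u]; last exact: (groupV U).
  under eq_bigr do rewrite invgK.
  rewrite (sum_multiplicative (f := B^~ g)); last by move=> x y Ux Uy; exact: Bl.
  by rewrite inE Ug.
rewrite (sum_multiplicative (f := B g)); last by move=> x y; exact: Br.
have -> : [forall h in U, B g h == 1] = (g \in lradical U B) by rewrite inE Ug.
rewrite cardsX natrM in_setI.
have U0 : #|U|%:R != 0 :> algC by exact: neq0CG.
case: (g \in rradical U B); last by rewrite andbF mulr0 !mul0r.
case: (g \in lradical U B); last by rewrite mulr0 mul0r.
by rewrite -[X in X / _]mulrA mulfK ?mulf_neq0.
Qed.

End Supercharacter.

End PatternGroup.

Theorem corollary5p1 (F : finFieldType) (theta : F -> algC)
    (htheta : nontrivial_additive_character theta)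
    (n : nat) (J : {set 'I_n.+1 * 'I_n.+1}) (hJ : closed_set J)
    (hchain : ~ exists i j k l : 'I_n.+1, four_chain J i j k l) :
  (forall X : 'M[F]_n.+1, X \in pattern_alg F J ->
     superclass J X \in classes (pattern_group F hJ))
  /\ (forall lam : pattern_dual F J,
        exists2 chi : 'CF(pattern_group F hJ),
          chi \in irr (pattern_group F hJ)
          & {in pattern_group F hJ, forall g, chi g = supercharacter theta lam g}).
Proof.
split=> [X nX | lam]; first exact: superclass_class.
have [|g h _ _|chi irr_chi chiE] := irr_quadratic (psi := pattern_psi theta lam)
    (pattern_bicharP hJ hchain lam htheta)
    (pattern_group_radicals hJ hchain lam htheta).
- by move=> g _; case: htheta => theta_neq0 _ _; exact: theta_neq0.
- exact: pattern_psiM.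
exists chi => // g Ug.
by rewrite chiE // supercharacterE.
Qed.
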